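(* Let $d\in\mathbb{N}$ and $p(z)=\sum_{k=0}^dc_kz^k$, $c_k\in\mathbb{C}$, $c_d\ne0$, $c_0\ne0$. Let $$\varphi_n(t)=\sum_{j=0}^n\binom njb_j\,t^{n-j},\qquad b_j=\left(\frac{1}{p(w)}\right)^{(j)}(0),\qquad n\in\mathbb{Z}_+.$$ The polynomials $\{\varphi_n(t)\}_{n=0}^\infty$ satisfy the recurrence relation $$(n+1)\sum_{k=0}^d\varphi_{n+1-k}(t)\frac{c_k}{(n+1-k)!}=t\left(\sum_{k=0}^d\varphi_{n-k}(t)\frac{c_k}{(n-k)!}\right),\qquad n\in\mathbb{Z}_+,$$ where $\varphi_r:=0$, $r!:=1$, for $r\in\mathbb{Z}$, $r<0$. The polynomials $\{\varphi_n(t)\}_{n=0}^\infty$ obey the differential equation $$t\sum_{k=0}^dc_k\varphi_n^{(k+1)}(t)=n\left(\sum_{k=0}^dc_k\varphi_n^{(k)}(t)\right),\qquad n\in\mathbb{Z}_+.$$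
   Context: $\mathbb{N}$: positive integers; $\mathbb{Z}_+$: non-negative integers. The superscript $(j)$ in $b_j$ denotes the $j$-th derivative with respect to $w$. (This is the case $g_n(t)=t^n$, $f(w)=1$, $u(w)=w$ of the polynomials $\varphi_n(t)=\sum_{j=0}^n\binom njb_jg_{n-j}(t)$, $b_j=\left(\frac1{p(u(w))}\right)^{(j)}(0)$, where $\sum_{n\ge0}g_n(t)w^n/n!=f(w)e^{tu(w)}$; equivalently, near $w=0$, $\sum_{n\ge0}\varphi_n(t)w^n/n!=\frac{1}{p(w)}e^{tw}$.) *)

(* Defs.v *)
From HB Require Import structures.
From mathcomp Require Import all_boot all_order all_algebra.
From mathcomp Require Import complex.
From mathcomp Require Import boolp classical_sets reals topology normedtype derive.
Set Implicit Arguments.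
Unset Strict Implicit.
Unset Printing Implicit Defensive.
Import Order.TTheory GRing.Theory Num.Theory.
Import numFieldNormedType.Exports.
Local Open Scope ring_scope.

(* [derive1n] is the analytic derivative; for K = R[i] the difference quotient
   ranges over complex increments, so this is the complex derivative. *)
Definition recip_deriv (K : numFieldType) (p : {poly K}) (j : nat) : K :=
  derive1n j (fun w : K => (p.[w])^-1) 0.

Definition phi (K : numFieldType) (p : {poly K}) (n : nat) : {poly K} :=
  \sum_(j < n.+1) ('C(n, j)%:R * recip_deriv p j) *: 'X^(n - j).

(* Extensions to integer indices by 0 and 1 respectively; [Negz m] is - (m + 1). *)
Definition phiz (K : numFieldType) (p : {poly K}) (r : int) : {poly K} :=
  match r with Posz n => phi p n | Negz _ => 0 end.

Definition factz (r : int) : nat :=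
  match r with Posz n => n`! | Negz _ => 1%N end.

(* Main.v *)
Require Import Defs.
From HB Require Import structures.
From mathcomp Require Import all_boot all_order all_algebra.
From mathcomp Require Import complex.
From mathcomp Require Import boolp classical_sets reals topology normedtype derive.
From mathcomp Require Import functions.
From mathcomp Require Import ring.
Import Order.TTheory GRing.Theory Num.Theory.
Import numFieldNormedType.Exports.
Local Open Scope ring_scope.

(** The identities amount to a single Cauchy product.  Write
    [beta_j = b_j / j!] for the Taylor coefficients of [1 / p] at [0]; since
    [p * (1 / p) = 1], they satisfy [sum_(k <= m) c_k beta_(m-k) = (m == 0)].
    As [phi_n / n!] has coefficients [beta_(n-i) / i!], applying this with
    [m = n - i] to each coefficient turns both
    [sum_k c_k phi_(n-k) / (n-k)!] into ['X^n / n!] ([phi_conv]) and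
    [sum_k c_k phi_n^(k)] into ['X^n] ([phi_diff]).  The recurrence then reads
    [(n+1) X^(n+1) / (n+1)! = X (X^n / n!)], and the differential equation is
    [X (X^n)' = n X^n].

    The analysis lies in relating the [b_j], which are iterated derivatives of
    a function, to the coefficients of [p].  Near any point where [p] does not
    vanish, the [j]-th derivative of [1 / p] is [N_j / p^(j+1)] for a polynomial
    [N_j] obtained by a formal quotient rule ([derive1n_recip]).  The map
    [q |-> N_j(q)], which gives the numerator of the [j]-th derivative of
    [q / p], is additive.  By Bezout, [1 = s p + h X^N], so [s] is the Taylor
    polynomial of [1 / p] modulo [X^N]: the term [s p] contributes the [j]-th
    derivative of [s] and, for [j < N], the term [h X^N] contributes a numerator
    vanishing at [0].  So [beta_j = s_j] ([recip_deriv_coef]), and the Cauchy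
    product is the coefficient of [X^m] in [s p = 1 - h X^N]. *)

(** * Derivatives of the reciprocal of a polynomial *)

Section Reciprocal.
Set Implicit Arguments.
Unset Strict Implicit.
Variable K : numFieldType.
Implicit Types p q s h : {poly K}.

Lemma is_derive_horner p (x : K) : is_derive x 1 (horner p) p^`().[x].
Proof.
elim/poly_ind: p => [|p c IHp].
  have -> : horner 0 = cst 0 :> (K -> K) by apply/funext => y; rewrite horner0.
  by rewrite deriv0 horner0; exact: is_derive_cst.
have -> : horner (p * 'X + c%:P) = horner p * id + cst c :> (K -> K).
  by apply/funext => y; rewrite !hornerE.
apply: is_derive_eq.
by rewrite derivMXaddC !hornerE /GRing.scale /= mulr1 [x * _]mulrC.
Qed.

Lemma near_horner_neq0 p (x : K) : p.[x] != 0 -> \forall y \near x, p.[y] != 0.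
Proof.
have [dp _] := is_derive_horner p x.
have cp : {for x, continuous (horner p)}.
  exact/differentiable_continuous/derivable1_diffP.
by move=> px0; exact: (cvgr_neq0 _ cp px0).
Qed.

(** The numerator, over the denominator [p ^+ j.+1], of the [j]-th derivative
    of [q / p]. *)
Fixpoint quot_numer p j q : {poly K} :=
  if j is i.+1 then
    (quot_numer p i q)^`() * p - (quot_numer p i q * p^`()) *+ i.+1
  else q.

Lemma quotient_rule (b b' q q' : K) n : b != 0 ->
  q * (- (b ^+ n.+1) ^- 2 * (b' * b ^+ n *+ n.+1)) + (b ^+ n.+1)^-1 * q'
  = (q' * b - q * b' *+ n.+1) / b ^+ n.+2.
Proof.
move=> b0; have bn : b ^+ n != 0 by rewrite expf_neq0.
rewrite !exprS expr0 mulr1; move: (b ^+ n) bn => a a0.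
by field; rewrite b0 a0.
Qed.

Lemma derive1n_recip p j (x : K) : p.[x] != 0 ->
  derive1n j (fun w : K => (p.[w])^-1) x
  = (quot_numer p j 1).[x] / p.[x] ^+ j.+1.
Proof.
elim: j x => [|j IHj] x px0; first by rewrite derive1n0 /= hornerC mul1r expr1.
rewrite derive1nS derive1E.
(* The formula of rank [j] holds on a neighbourhood of [x], not only at [x],
   so it can be differentiated. *)
rewrite (@near_eq_derive _ _ _ _
  (horner (quot_numer p j 1) * (fun y => (horner (p ^+ j.+1) y)^-1))); last first.
  near=> y; rewrite IHj -?horner_exp //.
  by near: y; exact: near_horner_neq0.
have pj0 : (p ^+ j.+1).[x] != 0 by rewrite horner_exp expf_neq0.
have [dq eq] := is_derive_horner (quot_numer p j 1) x.
have [dp ep] := is_derive_horner (p ^+ j.+1) x.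
rewrite deriveM ?deriveV //; last exact: derivableV.
rewrite eq ep deriv_exp /GRing.scale /= hornerD hornerN !hornerMn !hornerM.
by rewrite !horner_exp; exact: quotient_rule.
Unshelve. all: by end_near. Qed.

Lemma quot_numerD p j q1 q2 :
  quot_numer p j (q1 + q2) = quot_numer p j q1 + quot_numer p j q2.
Proof.
elim: j => [//|j IHj] /=.
by rewrite IHj derivD !mulrDl mulrnDl opprD addrACA.
Qed.

(** The function [s p / p] is [s], so its [j]-th derivative is that of [s]. *)
Lemma quot_numerM p j s : quot_numer p j (s * p) = s^`(j) * p ^+ j.+1.
Proof.
elim: j => [|j IHj] /=; first by rewrite expr1.
rewrite IHj derivM deriv_exp /= -derivnS !exprS; ring.
Qed.

(** Each differentiation lowers the order of vanishing at [0] by at most one. *)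
Lemma quot_numerXn p j m q :
  exists h, quot_numer p j (q * 'X^(m + j)) = h * 'X^m.
Proof.
elim: j m => [|j IHj] m; first by exists q; rewrite addn0.
have [h eh] := IHj m.+1.
exists ((h^`() * 'X + h *+ m.+1) * p - (h * 'X * p^`()) *+ j.+1).
rewrite -addSnnS /= eh derivM derivXn /= exprS; ring.
Qed.

(** Since [1 = s p + h X^N], the function [1 / p] is [s] plus a rational function
    vanishing at [0] to order [N], which derivatives of order less than [N] do
    not see. *)
Lemma recip_deriv_coef p s h N j : p.[0] != 0 -> s * p + h * 'X^N = 1 ->
  (j < N)%N -> recip_deriv p j = s`_j *+ j`!.
Proof.
move=> p0 e jN; rewrite /recip_deriv derive1n_recip // -e quot_numerD.
have [r] := quot_numerXn p j (N - j) h; rewrite subnK ?(ltnW jN) // => ->.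
rewrite quot_numerM hornerD !hornerM hornerXn !horner_exp.
rewrite expr0n subn_eq0 leqNgt jN mulr0 addr0 mulfK ?expf_neq0 //.
by rewrite horner_coef0 coef_derivn addn0 ffactnn.
Qed.

(** The coefficient of degree [m] in [p * (1 / p) = 1]. *)
Lemma recip_deriv_conv p m : p.[0] != 0 ->
  \sum_(k < m.+1) p`_k * (recip_deriv p (m - k) / (m - k)`!%:R)
  = (m == 0%N)%:R.
Proof.
move=> p0.
have /Bezout_eq1_coprimepP[[s h] /= e] : coprimep p 'X^(m.+1).
  by apply: coprimep_expr; rewrite coprimepX.
transitivity ((p * s)`_m).
  rewrite coefM; apply: eq_bigr => k _; congr (_ * _).
  rewrite (@recip_deriv_coef p s h m.+1) // ?ltnS ?leq_subr //.
  by rewrite -[s`_(m - k) *+ _]mulr_natr mulfK // pnatr_eq0 -lt0n fact_gt0.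
move/(congr1 (fun q : {poly K} => q`_m)): e.
by rewrite coefD coefMXn ltnSn addr0 coef1 mulrC.
Qed.

End Reciprocal.

(** * The two collapsing sums *)

Section Appell.
Set Implicit Arguments.
Unset Strict Implicit.
Variable K : numFieldType.
Implicit Type p : {poly K}.

Lemma natr_fact_neq0 n : n`!%:R != 0 :> K.
Proof. by rewrite pnatr_eq0 -lt0n fact_gt0. Qed.

Lemma coef_phi p n i : (phi p n)`_i =
  if (i <= n)%N then n`!%:R / i`!%:R * (recip_deriv p (n - i) / (n - i)`!%:R)
  else 0.
Proof.
rewrite /phi (reindex_inj rev_ord_inj) /=.
rewrite (eq_bigr (fun k : 'I_n.+1 =>
  ('C(n, k)%:R * recip_deriv p (n - k)) *: 'X^k)); last first.
  by move=> k _; rewrite subSS subKn ?bin_sub // -ltnS.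
rewrite -(poly_def n.+1 (fun k => 'C(n, k)%:R * recip_deriv p (n - k))).
rewrite coef_poly ltnS; case: leqP => // le_in.
rewrite -(bin_fact le_in) !natrM.
by field; rewrite !natr_fact_neq0.
Qed.

(** The Cauchy product naturally runs over [k <= m], but the sums to be
    evaluated run over [k <= d].  Either range can be enlarged at no cost:
    [p`_k] vanishes beyond [d], and the guard beyond [m]. *)
Lemma recip_deriv_conv_widen p d m : p.[0] != 0 -> (size p <= d.+1)%N ->
  \sum_(k < d.+1) p`_k *
    (if (k <= m)%N then recip_deriv p (m - k) / (m - k)`!%:R else 0)
  = (m == 0%N)%:R.
Proof.
move=> p0 sp; rewrite -(recip_deriv_conv m p0).
set F := fun k => p`_k *
  (if (k <= m)%N then recip_deriv p (m - k) / (m - k)`!%:R else 0).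
rewrite (big_ord_widen (maxn d m).+1 F) ?ltnS ?leq_maxl //.
rewrite (big_ord_widen (maxn d m).+1
  (fun k => p`_k * (recip_deriv p (m - k) / (m - k)`!%:R))) ?ltnS ?leq_maxr //.
rewrite big_mkcond [RHS]big_mkcond; apply: eq_bigr => k _.
rewrite /F !ltnS; case: leqP => kd; case: leqP => km //.
  by rewrite mulr0.
by rewrite nth_default ?mul0r // (leq_trans sp).
Qed.

(** The form in which the Cauchy product appears in the coefficient of ['X^i],
    where the guard [i + k <= n] also covers [i > n]. *)
Lemma recip_deriv_conv_coef p d n i (a : K) : p.[0] != 0 -> (size p <= d.+1)%N ->
  \sum_(k < d.+1) (if (i + k <= n)%N then
    a * (p`_k * (recip_deriv p (n - i - k) / (n - i - k)`!%:R)) else 0)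
  = a * (i == n)%:R.
Proof.
move=> p0 sp; case: (leqP i n) => ni; last first.
  rewrite (gtn_eqF ni) mulr0 big1 // => k _.
  by rewrite leqNgt (leq_trans ni) ?leq_addr.
rewrite eqn_leq ni -subn_eq0 -(recip_deriv_conv_widen (n - i) p0 sp) mulr_sumr.
by apply: eq_bigr => k _; rewrite -leq_subRL //; case: leqP; rewrite ?mulr0.
Qed.

Lemma phi_conv p d n : p.[0] != 0 -> (size p <= d.+1)%N ->
  \sum_(k < d.+1) (p`_k / (factz (n%:Z - k%:Z))%:R) *: phiz p (n%:Z - k%:Z)
  = n`!%:R^-1 *: 'X^n.
Proof.
move=> p0 sp; apply/polyP => i; rewrite coef_sum coefZ coefXn.
have term (k : nat) :
    ((p`_k / (factz (n%:Z - k%:Z))%:R) *: phiz p (n%:Z - k%:Z))`_i =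
    if (i + k <= n)%N then
      i`!%:R^-1 * (p`_k * (recip_deriv p (n - i - k) / (n - i - k)`!%:R))
    else 0.
  case: (leqP k n) => kn.
    rewrite subzn // coefZ /= coef_phi addnC -(leq_subRL i kn).
    case: leqP => _; last by rewrite mulr0.
    rewrite (subnAC n k i).
    by field; rewrite !natr_fact_neq0.
  rewrite leqNgt (leq_trans kn) ?leq_addl //= -opprB subzn ?(ltnW kn) //.
  have /prednK <- : (0 < k - n)%N by rewrite subn_gt0.
  by rewrite -NegzE /= scaler0 coef0.
rewrite (eq_bigr _ (fun (k : 'I_d.+1) _ => term k)).
rewrite recip_deriv_conv_coef //; have [->|_] := eqVneq i n => //.
by rewrite !mulr0.
Qed.

(** Differentiation acts on [phi_n / n!] by lowering [n]: the factor
    [(i + k) ^_ k] that it brings out cancels against [(i + k)!], leaving the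
    coefficient [beta_(n-i-k) / i!] of [phi_(n-k) / (n-k)!].  This sum is
    therefore [n!] times the one of [phi_conv]. *)
Lemma phi_diff p d n : p.[0] != 0 -> (size p <= d.+1)%N ->
  \sum_(k < d.+1) p`_k *: (phi p n)^`(k) = 'X^n.
Proof.
move=> p0 sp; apply/polyP => i; rewrite coef_sum coefXn.
have term (k : nat) : (p`_k *: (phi p n)^`(k))`_i =
    if (i + k <= n)%N then n`!%:R / i`!%:R *
      (p`_k * (recip_deriv p (n - i - k) / (n - i - k)`!%:R))
    else 0.
  rewrite coefZ coef_derivn coef_phi [(k + i)%N]addnC.
  case: leqP => _; last by rewrite mul0rn mulr0.
  have := ffact_fact (leq_addl i k); rewrite addnK => <-.
  rewrite natrM subnDA -[_ *+ (_ ^_ _)]mulr_natr.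
  have ff0 : ((i + k) ^_ k)%:R != 0 :> K.
    by rewrite pnatr_eq0 -lt0n ffact_gt0 leq_addl.
  by field; rewrite !natr_fact_neq0 ff0.
rewrite (eq_bigr _ (fun (k : 'I_d.+1) _ => term k)).
rewrite recip_deriv_conv_coef //; have [->|_] := eqVneq i n; last by rewrite mulr0.
by rewrite mulr1 divff ?natr_fact_neq0.
Qed.

End Appell.

Theorem corollary4 (R : realType) (d : nat) (c : nat -> R[i])
    (hd : (0 < d)%N) (hcd : c d != 0) (hc0 : c 0%N != 0) :
  let p : {poly R[i]} := \poly_(k < d.+1) c k in
  (forall n : nat,
     (n.+1)%:R *: (\sum_(k < d.+1)
        (c k / (factz (n.+1%:Z - k%:Z))%:R) *: phiz p (n.+1%:Z - k%:Z))
     = 'X * (\sum_(k < d.+1)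
        (c k / (factz (n%:Z - k%:Z))%:R) *: phiz p (n%:Z - k%:Z)))
  /\
  (forall n : nat,
     'X * (\sum_(k < d.+1) c k *: (phi p n)^`(k.+1))
     = n%:R *: (\sum_(k < d.+1) c k *: (phi p n)^`(k))).
Proof.
move=> p.
have sp : (size p <= d.+1)%N by exact: size_poly.
have cE (k : 'I_d.+1) : c k = p`_k by rewrite coef_poly ltn_ord.
have p0 : p.[0] != 0 by rewrite horner_coef0 coef_poly.
have conv n : \sum_(k < d.+1)
    (c k / (factz (n%:Z - k%:Z))%:R) *: phiz p (n%:Z - k%:Z) = n`!%:R^-1 *: 'X^n.
  by rewrite -(phi_conv n p0 sp); apply: eq_bigr => k _; rewrite cE.
have diff n : \sum_(k < d.+1) c k *: (phi p n)^`(k) = 'X^n.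
  by rewrite -(phi_diff n p0 sp); apply: eq_bigr => k _; rewrite cE.
split=> n.
  rewrite !conv -scalerAr -exprS scalerA factS natrM invfM mulrA.
  by rewrite divff ?mul1r // pnatr_eq0.
(* The left-hand sum is the derivative of the right-hand one. *)
rewrite (_ : \sum_(k < d.+1) _ = ('X^n)^`()); last first.
  by rewrite -(diff n) raddf_sum; apply: eq_bigr => k _; rewrite /= derivZ.
rewrite diff derivXn -mulr_natl mulrCA scaler_nat mulr_natl.
by case: n => [|n]; rewrite ?mulr0n // -exprS.
Qed.
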